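(* Let $H$ be the Hopf algebra over $\mathbb{F}_2$ with algebra $\mathbb{F}_2[x]/\langle x^4\rangle$ and \[ \Delta x=x\otimes1+1\otimes x+x^2\otimes x^2,\qquad \epsilon(x)=0,\qquad Sx=x.\] Then $H$ is self-dual, and its self-duality pairing on the basis $1,\ x,\ y=x^2,\ z=x^3$ is given by \[ \langle1,1\rangle=\langle x,y\rangle=\langle y,x\rangle=\langle z,z\rangle=1\] with all other pairings of basis elements equal to zero.
   Context: A self-duality pairing on $H$ is a nondegenerate bilinear form $\langle\ ,\ \rangle:H\otimes H\to\mathbb{F}_2$ with $\langle ab,c\rangle=\langle a\otimes b,\Delta c\rangle$, $\langle a,bc\rangle=\langle\Delta a,b\otimes c\rangle$, $\langle1,a\rangle=\epsilon(a)=\langle a,1\rangle$, where $\langle a\otimes b,c\otimes d\rangle=\langle a,c\rangle\langle b,d\rangle$. $H$ is self-dual if such a form exists, equivalently $H\cong H^*$ as Hopf algebras. *)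

(* Defs.v *)
From HB Require Import structures.
From mathcomp Require Import all_boot all_order all_algebra all_field.

Set Implicit Arguments.
Unset Strict Implicit.
Unset Printing Implicit Defensive.

Import GRing.Theory.
Local Open Scope ring_scope.

(* The tensor product of two finite-dimensional vector spaces, modelled by    *)
(* coordinate matrices: the entry at (i, j) is the coefficient of e_i (x) e_j,*)
(* for e the reference bases (vbasis {:A}) and (vbasis {:B}).  The alias keeps*)
(* the matrix product away from A (x) A; the product there is tmul below.     *)
(* tens_bilinear, tliftE and tens_ext give the universal property, so nothing *)
(* depends on the choice of bases.                                            *)
Definition tensor (K : fieldType) (A B : vectType K) : Type :=
  'M[K]_(\dim {:A}, \dim {:B}).

HB.instance Definition _ (K : fieldType) (A B : vectType K) :=
  Vector.copy (tensor A B) 'M[K]_(\dim {:A}, \dim {:B}).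

Section Tensor.
Variable K : fieldType.
Implicit Types A B C D V : vectType K.

Definition tens A B (a : A) (b : B) : tensor A B :=
  \matrix_(i, j) (coord (vbasis {:A}) i a * coord (vbasis {:B}) j b).

(* The linear map sending a (x) b to f a b, when f is bilinear.  For a general*)
(* f this only looks at the values of f on the reference bases.               *)
Definition tlift A B V (f : A -> B -> V) (t : tensor A B) : V :=
  \sum_i \sum_j t i j *: f (vbasis {:A})`_i (vbasis {:B})`_j.

Definition bilinear_map A B V (f : A -> B -> V) :=
  (forall b, linear (f^~ b)) /\ (forall a, linear (f a)).

Lemma tens_bilinear A B : bilinear_map (@tens A B).
Proof.
split=> [b k a a' | a k b b']; apply/matrixP=> i j; rewrite !mxE linearP.
  by rewrite [_ k _]/(k * _) mulrDl mulrA.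
by rewrite [_ k _]/(k * _) mulrDr mulrCA.
Qed.

Lemma bilinear_sum A B V (f : A -> B -> V) (a : A) (b : B) : bilinear_map f ->
  f a b = \sum_i \sum_j
    (coord (vbasis {:A}) i a * coord (vbasis {:B}) j b) *:
      f (vbasis {:A})`_i (vbasis {:B})`_j.
Proof.
move=> [fl fr].
pose fL b0 := HB.pack (f^~ b0) (GRing.isLinear.Build _ _ _ _ _ (fl b0))
  : {linear A -> V}.
pose fR a0 := HB.pack (f a0) (GRing.isLinear.Build _ _ _ _ _ (fr a0))
  : {linear B -> V}.
rewrite {1}(coord_vbasis (memvf a)) -[LHS]/(fL b _) linear_sum.
apply: eq_bigr => i _.
rewrite linearZ /= {1}(coord_vbasis (memvf b)) -[f _ _]/(fR _ _) linear_sum.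
rewrite scaler_sumr; apply: eq_bigr => j _.
by rewrite linearZ scalerA.
Qed.

Lemma tlift_is_linear A B V (f : A -> B -> V) : linear (tlift f).
Proof.
move=> k s t; rewrite /tlift scaler_sumr -big_split; apply: eq_bigr => i _ /=.
rewrite scaler_sumr -big_split; apply: eq_bigr => j _ /=.
by rewrite !mxE scalerDl scalerA.
Qed.

HB.instance Definition _ A B V (f : A -> B -> V) :=
  GRing.isLinear.Build K (tensor A B) V _ (tlift f) (tlift_is_linear f).

Lemma tliftE A B V (f : A -> B -> V) (a : A) (b : B) :
  bilinear_map f -> tlift f (tens a b) = f a b.
Proof.
move=> /bilinear_sum ->; apply: eq_bigr => i _; apply: eq_bigr => j _.
by rewrite mxE.
Qed.

Lemma tens_vbasis A B (i : 'I_(\dim {:A})) (j : 'I_(\dim {:B})) :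
  tens (vbasis {:A})`_i (vbasis {:B})`_j = delta_mx i j.
Proof.
apply/matrixP=> k l; rewrite !mxE !coord_free ?(basis_free (vbasisP _)) //.
by rewrite -natrM mulnb eq_sym (eq_sym l).
Qed.

Lemma tens_ext A B V (f g : {linear tensor A B -> V}) :
  (forall a b, f (tens a b) = g (tens a b)) -> f =1 g.
Proof.
move=> fg t; have -> : t = \sum_i \sum_j t i j *:
    tens (vbasis {:A})`_i (vbasis {:B})`_j.
  rewrite [LHS]matrix_sum_delta; apply: eq_bigr => i _.
  by apply: eq_bigr => j _; rewrite tens_vbasis.
rewrite !linear_sum; apply: eq_bigr => i _.
by rewrite !linear_sum; apply: eq_bigr => j _; rewrite !linearZ /= fg.
Qed.

Definition tmap A B C D (f : A -> C) (g : B -> D) : tensor A B -> tensor C D :=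
  tlift (fun a b => tens (f a) (g b)).

Definition tassoc A B C : tensor (tensor A B) C -> tensor A (tensor B C) :=
  tlift (fun ab c => tlift (fun a b => tens a (tens b c)) ab).

Definition tmul (A : falgType K) (s t : tensor A A) : tensor A A :=
  tlift (fun a b => tlift (fun c d => tens (a * c) (b * d)) t) s.

Definition mul_map (A : falgType K) : tensor A A -> A :=
  tlift (fun a b => a * b).

End Tensor.

Record hopf (K : fieldType) (H : falgType K) := Hopf {
  comul : {linear H -> tensor H H};
  counit : {linear H -> K^o};
  antipode : {linear H -> H};
  comulA : forall a,
    tassoc (tmap comul id (comul a)) = tmap id comul (comul a);
  counitl : forall a, tlift (fun b c => counit b *: c) (comul a) = a;
  counitr : forall a, tlift (fun b c => counit c *: b) (comul a) = a;
  comulM : forall a b, comul (a * b) = tmul (comul a) (comul b);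
  comul1 : comul 1 = tens 1 1;
  counitM : forall a b, counit (a * b) = counit a * counit b;
  counit1 : counit 1 = 1;
  antipodel : forall a,
    mul_map (tmap antipode id (comul a)) = (counit a)%:A;
  antipoder : forall a,
    mul_map (tmap id antipode (comul a)) = (counit a)%:A
}.

Section SelfDuality.
Variables (K : fieldType) (H : falgType K).

(* <a (x) b, c (x) d> = <a, c> <b, d>, extended bilinearly. *)
Definition pairing2 (B : {linear tensor H H -> K^o}) (s t : tensor H H) : K^o :=
  tlift (fun a b => tlift (fun c d => B (tens a c) * B (tens b d) : K^o) t) s.

Record self_duality_pairing (h : hopf H) (B : {linear tensor H H -> K^o}) :
    Prop := SelfDualityPairing {
  pairing_nondegl : forall a, (forall b, B (tens a b) = 0) -> a = 0;
  pairing_nondegr : forall b, (forall a, B (tens a b) = 0) -> b = 0;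
  pairing_mull : forall a b c,
    B (tens (a * b) c) = pairing2 B (tens a b) (comul h c);
  pairing_mulr : forall a b c,
    B (tens a (b * c)) = pairing2 B (comul h a) (tens b c);
  pairing_1l : forall a, B (tens 1 a) = counit h a;
  pairing_1r : forall a, B (tens a 1) = counit h a
}.

Definition self_dual (h : hopf H) := exists B, self_duality_pairing h B.

End SelfDuality.

(* {poly %/ p} is the quotient by mk_monic p, which is p here: 'X^4 is monic. *)
Definition F2X4_carrier : Type := {poly %/ ('X^4 : {poly 'F_2})}.

HB.instance Definition _ := GRing.ComUnitAlgebra.on F2X4_carrier.
HB.instance Definition _ := Vector.on F2X4_carrier.

Definition F2X4 : falgType 'F_2 := F2X4_carrier.

Definition X : F2X4 := ('qX : F2X4_carrier).

Definition hopf_formulas (h : hopf F2X4) :=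
  [/\ comul h X = tens X 1 + tens 1 X + tens (X ^+ 2) (X ^+ 2),
      counit h X = 0
    & antipode h X = X].

(* Main.v *)
Require Import Defs.
From HB Require Import structures.
From mathcomp Require Import all_boot all_order all_algebra all_field.
From mathcomp Require Import ring.
Import GRing.Theory.
Local Open Scope ring_scope.

(* In characteristic 2 the element Delta x = x (x) 1 + 1 (x) x + x^2 (x) x^2 of
   H (x) H has square x^2 (x) 1 + 1 (x) x^2 and fourth power 0, so x |-> Delta x
   extends to an algebra map on F_2[x]/(x^4); the remaining Hopf axioms are
   linear and are checked on 1, x, x^2, x^3.  Conversely the formula for Delta x
   determines comul and counit on all powers of x.  In the coordinates a_i of
   a = sum_i a_i x^i the pairing is
     <a, b> = a_0 b_0 + a_1 b_2 + a_2 b_1 + a_3 b_3,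
   and the pairing axioms become polynomial identities in the coordinates. *)

Set Implicit Arguments.
Unset Strict Implicit.
Unset Printing Implicit Defensive.

(** * Linearity of the tensor constructions and their values on pure tensors *)

Section TensorCalculus.
Variable K : fieldType.
Implicit Types A B C D V : vectType K.

HB.instance Definition _ A B (a : A) :=
  GRing.isLinear.Build K B (tensor A B) _ (tens a)
    ((tens_bilinear A B).2 a).

Lemma tensPl A B (k : K) (a a' : A) (b : B) :
  tens (k *: a + a') b = k *: tens a b + tens a' b.
Proof. exact: ((tens_bilinear A B).1 b k a a'). Qed.

Lemma tensDl A B (a a' : A) (b : B) : tens (a + a') b = tens a b + tens a' b.
Proof. by rewrite -[a]scale1r tensPl !scale1r. Qed.

Lemma tens0l A B (b : B) : tens (0 : A) b = 0.
Proof. by have := tensPl (-1) (0 : A) 0 b; rewrite !scaleN1r !addNr. Qed.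

(** [tassoc], [tmul] and [pairing2] contain nested lifts. Their linearity in the inner argument
    comes from linearity of [tlift] in the function being lifted. *)
Lemma tlift_comb A B V (k : K) (f g : A -> B -> V) (t : tensor A B) :
  tlift (fun a b => k *: f a b + g a b) t = k *: tlift f t + tlift g t.
Proof.
rewrite /tlift scaler_sumr -big_split; apply: eq_bigr => i _ /=.
rewrite scaler_sumr -big_split; apply: eq_bigr => j _ /=.
by rewrite scalerDr !scalerA mulrC.
Qed.

HB.instance Definition _ A B C D (f : A -> C) (g : B -> D) :=
  GRing.Linear.copy (tmap f g) (tlift (fun a b => tens (f a) (g b))).

HB.instance Definition _ A B C :=
  GRing.Linear.copy (@tassoc K A B C)
    (tlift (fun ab c => tlift (fun a b => tens a (tens b c)) ab)).

HB.instance Definition _ (A : falgType K) :=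
  GRing.Linear.copy (@mul_map K A) (tlift (fun a b => a * b)).

Lemma tmapE A B C D (f : {linear A -> C}) (g : {linear B -> D}) a b :
  tmap f g (tens a b) = tens (f a) (g b).
Proof.
rewrite /tmap tliftE //; split=> [b' k a1 a2 | a' k b1 b2]; rewrite !linearP //.
exact: tensPl.
Qed.

Lemma tassocE A B C (a : A) (b : B) (c : C) :
  tassoc (tens (tens a b) c) = tens a (tens b c).
Proof.
rewrite /tassoc tliftE; last first.
  split=> [c' k s t | t k c1 c2]; first exact: linearP.
  rewrite -tlift_comb; apply: eq_bigr => i _; apply: eq_bigr => j _.
  by rewrite !linearP.
rewrite tliftE //; split=> [b' k a1 a2 | a' k b1 b2]; last by rewrite tensPl linearP.
exact: tensPl.
Qed.

Lemma mul_mapE (A : falgType K) (a b : A) : mul_map (tens a b) = a * b.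
Proof.
rewrite /mul_map tliftE //; split=> [b' k a1 a2 | a' k b1 b2].
  by rewrite mulrDl scalerAl.
by rewrite mulrDr scalerAr.
Qed.

(** * The tensor square as an associative unital algebra *)

Lemma tmul_bilinear (A : falgType K) : bilinear_map (@tmul K A).
Proof.
split=> [t k s s' | s k t t']; first exact: linearP.
rewrite -tlift_comb; apply: eq_bigr => i _; apply: eq_bigr => j _.
by rewrite linearP.
Qed.

HB.instance Definition _ (A : falgType K) (s : tensor A A) :=
  GRing.isLinear.Build K (tensor A A) (tensor A A) _ (tmul s)
    ((tmul_bilinear A).2 s).

Lemma tmulPl (A : falgType K) (k : K) (s s' t : tensor A A) :
  tmul (k *: s + s') t = k *: tmul s t + tmul s' t.
Proof. exact: linearP. Qed.

Lemma tmulE (A : falgType K) (a b c d : A) :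
  tmul (tens a b) (tens c d) = tens (a * c) (b * d).
Proof.
rewrite /tmul tliftE; last first.
  split=> [b' k a1 a2 | a' k b1 b2]; rewrite -tlift_comb;
  apply: eq_bigr => i _; apply: eq_bigr => j _; rewrite mulrDl -scalerAl.
    by rewrite tensPl.
  by rewrite linearP.
rewrite tliftE //; split=> [b' k a1 a2 | a' k b1 b2]; rewrite mulrDr -scalerAr.
  by rewrite tensPl.
by rewrite linearP.
Qed.

(** Matrix units are pure tensors of basis vectors, so pure tensors span. *)
Lemma tens_ind A B (P : tensor A B -> Prop) :
    (forall k s t, P s -> P t -> P (k *: s + t)) ->
    (forall a b, P (tens a b)) ->
  forall t, P t.
Proof.
(* Zero is itself a pure tensor, which gives the base case for the sums. *)
move=> PL Ptens t; have P0 : P 0 by rewrite -(tens0l _ 0).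
rewrite [t]matrix_sum_delta; elim/big_ind: _ => // [u v Pu Pv|i _].
  by rewrite -[u]scale1r; apply: PL.
elim/big_ind: _ => // [u v Pu Pv|j _]; first by rewrite -[u]scale1r; apply: PL.
by rewrite -tens_vbasis -[_ *: _]addr0; apply: PL.
Qed.

Lemma tmulA (A : falgType K) : associative (@tmul K A).
Proof.
elim/tens_ind => [k s1 s2 IH1 IH2 t u | a1 b1]; first by rewrite !tmulPl IH1 IH2.
elim/tens_ind => [k t1 t2 IH1 IH2 u | a2 b2].
  by rewrite !(tmulPl, linearP) /= IH1 IH2.
elim/tens_ind => [k u1 u2 IH1 IH2 | a3 b3]; first by rewrite !linearP /= IH1 IH2.
by rewrite !tmulE !mulrA.
Qed.

Lemma tmul1t (A : falgType K) : left_id (tens 1 1) (@tmul K A).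
Proof.
elim/tens_ind => [k s t IHs IHt | a b]; first by rewrite linearP /= IHs IHt.
by rewrite tmulE !mul1r.
Qed.

Lemma tmult1 (A : falgType K) : right_id (tens 1 1) (@tmul K A).
Proof.
elim/tens_ind => [k s t IHs IHt | a b]; first by rewrite tmulPl IHs IHt.
by rewrite tmulE !mulr1.
Qed.

Lemma tmulDl (A : falgType K) (s s' t : tensor A A) :
  tmul (s + s') t = tmul s t + tmul s' t.
Proof. by rewrite -[s in LHS]scale1r tmulPl scale1r. Qed.

Lemma tmap_id A B (t : tensor A B) : tmap id id t = t.
Proof.
(* [tmapE] asks for linear maps; [idfun] carries that structure and is convertible to [id]. *)
have tE := @tmapE A B A B (@idfun A) (@idfun B).
elim/tens_ind: t => [k s t IHs IHt|a b]; last exact: tE.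
by rewrite linearP /= IHs IHt.
Qed.

(** * The induced pairing on the tensor square *)

Lemma pairing2_bilinear (A : falgType K) (B : {linear tensor A A -> K^o}) :
  bilinear_map (pairing2 B).
Proof.
split=> [t k s s' | s k t t']; first exact: linearP.
rewrite -tlift_comb; apply: eq_bigr => i _; apply: eq_bigr => j _.
by rewrite linearP.
Qed.

Lemma pairing2Dl (A : falgType K) (B : {linear tensor A A -> K^o}) s s' t :
  pairing2 B (s + s') t = pairing2 B s t + pairing2 B s' t.
Proof. exact: linearD. Qed.

Lemma pairing2Zl (A : falgType K) (B : {linear tensor A A -> K^o}) k s t :
  pairing2 B (k *: s) t = k *: pairing2 B s t.
Proof. exact: linearZ. Qed.

Lemma pairing2Dr (A : falgType K) (B : {linear tensor A A -> K^o}) s t t' :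
  pairing2 B s (t + t') = pairing2 B s t + pairing2 B s t'.
Proof. by rewrite -[t in LHS]scale1r (pairing2_bilinear B).2 scale1r. Qed.

Lemma pairing2Zr (A : falgType K) (B : {linear tensor A A -> K^o}) k s t :
  pairing2 B s (k *: t) = k *: pairing2 B s t.
Proof.
have p0 : pairing2 B s 0 = 0.
  by have := (pairing2_bilinear B).2 s (-1) 0 0; rewrite !scaleN1r !addNr.
by rewrite -[k *: t in LHS]addr0 (pairing2_bilinear B).2 p0 addr0.
Qed.

Lemma pairing2E (A : falgType K) (B : {linear tensor A A -> K^o}) (a b c d : A) :
  pairing2 B (tens a b) (tens c d) = B (tens a c) * B (tens b d).
Proof.
have BP k s t : B (k *: s + t) = k * B s + B t by rewrite linearP.
rewrite /pairing2 tliftE; last first.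
  split=> [b' k a1 a2 | a' k b1 b2]; rewrite -tlift_comb;
    apply: eq_bigr => i _; apply: eq_bigr => j _; rewrite tensPl BP.
    by rewrite mulrDl -mulrA.
  by rewrite mulrDr mulrCA.
rewrite tliftE //; split=> [b' k a1 a2 | a' k b1 b2].
  by rewrite (linearP (tens _)) BP mulrDl -mulrA.
by rewrite (linearP (tens _)) BP mulrDr mulrCA.
Qed.

(* Here x, y, z stand for X, X^2, X^3: these rewrites become very slow on the
   concrete algebra F2X4. *)
Section GenericFormulas.
Variables (A : falgType K) (x y z : A).

Section Coassoc.
Variable D : {linear A -> tensor A A}.
Hypothesis D1 : D 1 = tens 1 1.
Hypothesis Dx : D x = tens x 1 + tens 1 x + tens y y.
Hypothesis Dy : D y = tens y 1 + tens 1 y.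
Hypothesis Dz : D z = tens z 1 + tens y x + tens x y + tens 1 z.

Let tl a b : tmap D id (tens a b) = tens (D a) b := tmapE D (@idfun A) a b.
Let tr a b : tmap id D (tens a b) = tens a (D b) := tmapE (@idfun A) D a b.
Let DE := (D1, Dx, Dy, Dz).

Definition coassoc_at a := tassoc (tmap D id (D a)) = tmap id D (D a).

Lemma coassoc_atP k a b :
  coassoc_at a -> coassoc_at b -> coassoc_at (k *: a + b).
Proof. by rewrite /coassoc_at => IHa IHb; rewrite !linearP /= IHa IHb. Qed.

Lemma coassoc_at1 : coassoc_at 1.
Proof. by rewrite /coassoc_at DE tl tr DE tassocE. Qed.

Lemma coassoc_atx : coassoc_at x.
Proof.
rewrite /coassoc_at DE !linearD /= !tl !tr !DE !linearD /= !tensDl !linearD /= !tassocE.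
(* Both sides are the same six pure tensors. The right side groups them as x (x) 1 (x) 1, 1 (x) Dx
   and y (x) Dy. *)
by rewrite (AC (4*2) (1*(2*4*6)*(3*5))).
Qed.

Lemma coassoc_aty : coassoc_at y.
Proof.
rewrite /coassoc_at DE !linearD /= !tl !tr !DE !linearD /= !tensDl !linearD /= !tassocE.
by rewrite !addrA.
Qed.

Lemma coassoc_atz : coassoc_at z.
Proof.
rewrite /coassoc_at DE !linearD /= !tl !tr !DE !linearD /= !tensDl !linearD /= !tassocE.
(* The same ten pure tensors, regrouped as z (x) 1 (x) 1, y (x) Dx, x (x) Dy and 1 (x) Dz. *)
by rewrite (AC (4*2*3*1) (1*(2*5*9)*(3*7)*(4*6*8*10))).
Qed.

End Coassoc.

(** The second argument is the comultiplication of an element with coordinates k0, ..., k3, so the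
    pairing axiom turns into a scalar identity. *)
Lemma pairing2_comulr (B : {linear tensor A A -> K^o}) (k0 k1 k2 k3 : K) a b :
  pairing2 B (tens a b)
    (k0 *: tens 1 1 + k1 *: (tens x 1 + tens 1 x + tens y y)
     + k2 *: (tens y 1 + tens 1 y)
     + k3 *: (tens z 1 + tens y x + tens x y + tens 1 z)) =
  let p c d := B (tens a c) * B (tens b d) in
  k0 * p 1 1 + k1 * (p x 1 + p 1 x + p y y) + k2 * (p y 1 + p 1 y)
  + k3 * (p z 1 + p y x + p x y + p 1 z).
Proof. by rewrite !(pairing2Dr, pairing2Zr) !pairing2E. Qed.

Lemma pairing2_comull (B : {linear tensor A A -> K^o}) (k0 k1 k2 k3 : K) a b :
  pairing2 B
    (k0 *: tens 1 1 + k1 *: (tens x 1 + tens 1 x + tens y y)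
     + k2 *: (tens y 1 + tens 1 y)
     + k3 *: (tens z 1 + tens y x + tens x y + tens 1 z)) (tens a b) =
  let p c d := B (tens c a) * B (tens d b) in
  k0 * p 1 1 + k1 * (p x 1 + p 1 x + p y y) + k2 * (p y 1 + p 1 y)
  + k3 * (p z 1 + p y x + p x y + p 1 z).
Proof. by rewrite !(pairing2Dl, pairing2Zl) !pairing2E. Qed.

End GenericFormulas.

End TensorCalculus.

(** * Coordinates in F_2[x]/(x^4) *)

Definition xcoef (i : nat) (a : F2X4) : ('F_2)^o :=
  (a : {poly_ _ 'F_2})`_i.

Lemma xcoef_is_linear i : linear (xcoef i).
Proof. by move=> k a b; rewrite /xcoef coefD coefZ. Qed.

HB.instance Definition _ i :=
  GRing.isLinear.Build 'F_2 F2X4 _ _ (xcoef i) (xcoef_is_linear i).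

Lemma size_F2X4 : (size (mk_monic ('X^4 : {poly 'F_2}))).-1 = 4%N.
Proof. by rewrite mk_monic_Xn size_polyXn. Qed.

(** Reduction modulo X^4 is truncation below degree 4. *)
Lemma polyn_F2X4M (a b : F2X4_carrier) :
  polyn (a * b) = take_poly 4 (polyn a * polyn b).
Proof.
rewrite poly_of_qpolyM Pdiv.RingMonic.take_poly_rmodp.
by congr (Pdiv.CommonRing.rmodp _ _); exact: mk_monic_Xn.
Qed.

Lemma xcoefM (a b : F2X4) i : (i < 4)%N ->
  xcoef i (a * b) = \sum_(j < i.+1) xcoef j a * xcoef (i - j) b.
Proof. by move=> i4; rewrite /xcoef polyn_F2X4M coef_take_poly i4 coefM. Qed.

Lemma xcoefM0 (a b : F2X4) : xcoef 0 (a * b) = xcoef 0 a * xcoef 0 b.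
Proof. by rewrite xcoefM // big_ord1. Qed.

Lemma xcoefM1 (a b : F2X4) :
  xcoef 1 (a * b) = xcoef 0 a * xcoef 1 b + xcoef 1 a * xcoef 0 b.
Proof. by rewrite xcoefM // !big_ord_recr big_ord0 /= add0r. Qed.

Lemma xcoefM2 (a b : F2X4) : xcoef 2 (a * b) =
  xcoef 0 a * xcoef 2 b + xcoef 1 a * xcoef 1 b + xcoef 2 a * xcoef 0 b.
Proof. by rewrite xcoefM // !big_ord_recr big_ord0 /= add0r. Qed.

Lemma xcoefM3 (a b : F2X4) : xcoef 3 (a * b) =
  xcoef 0 a * xcoef 3 b + xcoef 1 a * xcoef 2 b + xcoef 2 a * xcoef 1 b
  + xcoef 3 a * xcoef 0 b.
Proof. by rewrite xcoefM // !big_ord_recr big_ord0 /= add0r. Qed.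

Lemma xcoefX n i : (i < 4)%N -> xcoef i (X ^+ n) = (i == n)%:R.
Proof.
have -> : xcoef i (X ^+ n) = (take_poly 4 (polyn (X : F2X4_carrier) ^+ n))`_i.
  rewrite /xcoef poly_of_qpolyX Pdiv.RingMonic.take_poly_rmodp.
  by congr (Pdiv.CommonRing.rmodp _ _)`_i; exact: mk_monic_Xn.
by move=> i4; rewrite qpolyXE ?size_polyXn ?monicXn // coef_take_poly i4 coefXn.
Qed.

Lemma xcoef1 i : (i < 4)%N -> xcoef i 1 = (i == 0)%:R.
Proof. exact: (xcoefX 0). Qed.

Lemma xcoefX1 i : (i < 4)%N -> xcoef i X = (i == 1)%:R.
Proof. exact: (xcoefX 1). Qed.

Definition xcoefE := (xcoef1, xcoefX1, xcoefX).

Lemma xcoefP (a b : F2X4) : (forall i, (i < 4)%N -> xcoef i a = xcoef i b) -> a = b.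
Proof.
move=> ab; apply/npolyP => i; have [i4|i4] := ltnP i 4; first exact: ab.
(* Representatives have degree below 4, so both coefficients vanish. *)
by rewrite !big_coef_npoly ?size_F2X4.
Qed.

Lemma X4 : X ^+ 4 = 0.
Proof. by apply: xcoefP => i i4; rewrite xcoefX // linear0 ltn_eqF. Qed.

Lemma xcoef_sum (a : F2X4) : a = \sum_(i < 4) xcoef i a *: X ^+ i.
Proof.
apply: xcoefP => i i4; rewrite linear_sum (bigD1 (Ordinal i4)) //= linearZ /=.
rewrite xcoefX // eqxx [_ *: _]mulr1 big1 ?addr0 // => j /negPf ji.
by rewrite linearZ /= xcoefX // eq_sym (_ : (j == i :> nat) = false) ?scaler0.
Qed.

(** The four powers span and the dimension is 4. *)
Lemma basis_X : basis_of {:F2X4} [:: 1; X; X ^+ 2; X ^+ 3].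
Proof.
rewrite basisEdim; apply/andP; split; last first.
  by rewrite /= dim_polyn size_F2X4.
apply/subvP => a _; rewrite (xcoef_sum a); apply: memv_suml => i _.
apply: rpredZ; apply: memv_span.
by case: i => [[|[|[|[|]]]]] //= _; rewrite !inE ?expr0 ?expr1 eqxx ?orbT.
Qed.

Lemma F2X4_ind (P : F2X4 -> Prop) :
    (forall k a b, P a -> P b -> P (k *: a + b)) ->
    (forall n, (n < 4)%N -> P (X ^+ n)) ->
  forall a, P a.
Proof.
move=> PL PX a; have P0 : P 0.
  (* Zero is obtained as (-1) 1 + 1. *)
  by rewrite -(addNr 1) -scaleN1r; apply: PL; apply: (PX 0).
rewrite (xcoef_sum a); elim/big_ind: _ => // [u v Pu Pv|i _].
  by rewrite -[u]scale1r; apply: PL.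
by rewrite -[_ *: _]addr0; apply: PL => //; apply: PX.
Qed.

(** * Powers of Delta x and the comultiplication *)

Lemma addF2 (V : lmodType 'F_2) (v : V) : v + v = 0.
Proof. by rewrite -mulr2n -scaler_nat (_ : 2%:R = 0) ?scale0r //; apply: val_inj. Qed.

Definition comulX : tensor F2X4 F2X4 :=
  tens X 1 + tens 1 X + tens (X ^+ 2) (X ^+ 2).

(** The n-th power of Delta x for [tmul], written as an iteration because [tensor] is given only a
    vector space structure. *)
Definition comulXn n := iter n (tmul comulX) (tens 1 1).
Arguments comulXn : simpl never.

Lemma comulXnD m n : comulXn (m + n) = tmul (comulXn m) (comulXn n).
Proof.
elim: m => [|m IHm]; first by rewrite tmul1t.
by rewrite addSn /comulXn /= -!/(comulXn _) IHm tmulA.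
Qed.

Lemma comulXn0 : comulXn 0 = tens 1 1.
Proof. by []. Qed.

Lemma comulXn1 : comulXn 1 = comulX.
Proof. exact: tmult1. Qed.

Lemma X_exp_ge4 n : (4 <= n)%N -> X ^+ n = 0.
Proof. by move=> n4; rewrite -(subnK n4) exprD X4 mulr0. Qed.

Lemma comulXn2 : comulXn 2 = tens (X ^+ 2) 1 + tens 1 (X ^+ 2).
Proof.
rewrite (comulXnD 1 1) comulXn1.
rewrite !linearD /= !tmulDl !tmulE !mulr1 !mul1r -!exprD -!exprS -!exprSr.
rewrite !addnE /= X4 linear0 addr0 -!expr2.
(* Of the eight products left, x^2 (x) 1 and 1 (x) x^2 occur once; x (x) x, x^3 (x) x^2 and x^2 (x)
   x^3 occur twice and cancel. *)
by rewrite (AC (3*3*2) (1*5*(2*4)*(3*7)*(6*8))) /= !addF2 !addr0.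
Qed.

Lemma comulXn3 : comulXn 3 =
  tens (X ^+ 3) 1 + tens (X ^+ 2) X + tens X (X ^+ 2) + tens 1 (X ^+ 3).
Proof.
rewrite (comulXnD 1 2) comulXn1 comulXn2.
rewrite !linearD /= !tmulDl !tmulE !mulr1 !mul1r -!exprD -!exprS.
by rewrite !addnE /= X4 linear0 tens0l !addr0 !addrA.
Qed.

Lemma comulXn_ge4 n : (4 <= n)%N -> comulXn n = 0.
Proof.
(* Squaring x^2 (x) 1 + 1 (x) x^2 gives two terms containing x^4 and twice the cross term x^2 (x)
   x^2. *)
have comulXn4 : comulXn 4 = 0.
  rewrite (comulXnD 2 2) comulXn2 !linearD /= !tmulDl !tmulE !mulr1 !mul1r -!exprD.
  by rewrite !addnE /= X4 linear0 tens0l add0r addr0 addF2.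
by move=> n4; rewrite -(subnK n4) comulXnD comulXn4 linear0.
Qed.

Definition F2X4_comul (a : F2X4) : tensor F2X4 F2X4 :=
  \sum_(i < 4) xcoef i a *: comulXn i.

Lemma F2X4_comul_is_linear : linear F2X4_comul.
Proof.
move=> k a b; rewrite /F2X4_comul scaler_sumr -big_split.
by apply: eq_bigr => i _; rewrite linearP scalerDl scalerA.
Qed.

HB.instance Definition _ := GRing.isLinear.Build 'F_2 F2X4 (tensor F2X4 F2X4) _
  F2X4_comul F2X4_comul_is_linear.

(** From exponent 4 on both sides vanish. Having every exponent covered reduces multiplicativity on
    monomials to addition of exponents. *)
Lemma F2X4_comulXn n : F2X4_comul (X ^+ n) = comulXn n.
Proof.
have [n4|n4] := ltnP n 4; last by rewrite X_exp_ge4 // linear0 comulXn_ge4.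
rewrite /F2X4_comul (bigD1 (Ordinal n4)) //= xcoefX // eqxx scale1r big1 ?addr0 //.
by move=> j /negPf ji; rewrite xcoefX // (_ : (j == n :> nat) = false) ?scale0r.
Qed.

Lemma F2X4_comul1 : F2X4_comul 1 = tens 1 1.
Proof. exact: (F2X4_comulXn 0). Qed.

Lemma F2X4_comulX : F2X4_comul X = comulX.
Proof. by rewrite (F2X4_comulXn 1) comulXn1. Qed.

Lemma F2X4_comulX2 : F2X4_comul (X ^+ 2) = tens (X ^+ 2) 1 + tens 1 (X ^+ 2).
Proof. by rewrite (F2X4_comulXn 2) comulXn2. Qed.

Lemma F2X4_comulX3 : F2X4_comul (X ^+ 3) =
  tens (X ^+ 3) 1 + tens (X ^+ 2) X + tens X (X ^+ 2) + tens 1 (X ^+ 3).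
Proof. by rewrite (F2X4_comulXn 3) comulXn3. Qed.

Definition F2X4_comulE :=
  (F2X4_comul1, F2X4_comulX, F2X4_comulX2, F2X4_comulX3).

Lemma F2X4_comulM a b :
  F2X4_comul (a * b) = tmul (F2X4_comul a) (F2X4_comul b).
Proof.
elim/F2X4_ind: a => [k a1 a2 IH1 IH2|m _].
  by rewrite mulrDl -scalerAl !linearP /= IH1 IH2 tmulPl.
elim/F2X4_ind: b => [k b1 b2 IH1 IH2|n _].
  by rewrite mulrDr -scalerAr !linearP /= IH1 IH2.
by rewrite -exprD !F2X4_comulXn comulXnD.
Qed.

(** * Remaining Hopf axioms, and uniqueness of comultiplication and counit *)

Lemma F2X4_counitl a :
  tlift (fun b c => xcoef 0 b *: c) (F2X4_comul a) = a.
Proof.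
have tE b c : tlift (fun b c : F2X4 => xcoef 0 b *: c) (tens b c) = xcoef 0 b *: c.
  rewrite tliftE //; split=> [c' k b1 b2|b' k c1 c2].
    by rewrite linearP scalerDl scalerA.
  by rewrite scalerDr !scalerA mulrC.
elim/F2X4_ind: a => [k a1 a2 IH1 IH2|n]; first by rewrite !linearP /= IH1 IH2.
case: n => [|[|[|[|//]]]] _; rewrite ?expr0 ?expr1 F2X4_comulE /comulX ?linearD /= !tE;
  by rewrite !xcoefE //= ?(scale0r, scale1r, add0r, addr0).
Qed.


Lemma F2X4_counitr a :
  tlift (fun b c => xcoef 0 c *: b) (F2X4_comul a) = a.
Proof.
have tE b c : tlift (fun b c : F2X4 => xcoef 0 c *: b) (tens b c) = xcoef 0 c *: b.
  rewrite tliftE //; split=> [c' k b1 b2|b' k c1 c2].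
    by rewrite scalerDr !scalerA mulrC.
  by rewrite linearP scalerDl scalerA.
elim/F2X4_ind: a => [k a1 a2 IH1 IH2|n]; first by rewrite !linearP /= IH1 IH2.
case: n => [|[|[|[|//]]]] _; rewrite ?expr0 ?expr1 F2X4_comulE /comulX ?linearD /= !tE;
  by rewrite !xcoefE //= ?(scale0r, scale1r, add0r, addr0).
Qed.

(** With the identity as antipode, both antipode axioms become this one. On x, x^2, x^3 the product
    gives 2x + x^4, 2x^2 and 4x^3, all zero. *)
Lemma F2X4_antipode a : mul_map (F2X4_comul a) = (xcoef 0 a)%:A.
Proof.
elim/F2X4_ind: a => [k a1 a2 IH1 IH2|n].
  by rewrite !linearP /= IH1 IH2 scalerDl scalerA.
case: n => [|[|[|[|//]]]] _; rewrite ?expr0 ?expr1 F2X4_comulE /comulX ?linearD /= !mul_mapE;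
  rewrite !xcoefE //= ?(mul1r, mulr1) ?(scale0r, scale1r) -?exprD -?exprS -?exprSr;
  by rewrite ?addF2 ?add0r ?addF2 // X_exp_ge4.
Qed.

Lemma F2X4_comulA a :
  tassoc (tmap F2X4_comul id (F2X4_comul a)) = tmap id F2X4_comul (F2X4_comul a).
Proof.
apply: (F2X4_ind (P := coassoc_at F2X4_comul)); first exact: coassoc_atP.
case=> [|[|[|[|//]]]] _; rewrite ?expr0 ?expr1.
- exact: coassoc_at1 F2X4_comul1.
- exact: coassoc_atx F2X4_comul1 F2X4_comulX F2X4_comulX2.
- exact: coassoc_aty F2X4_comul1 F2X4_comulX2.
exact: coassoc_atz F2X4_comul1 F2X4_comulX F2X4_comulX2 F2X4_comulX3.
Qed.

Lemma F2X4_comul_sum a : F2X4_comul a =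
  xcoef 0 a *: tens 1 1 + xcoef 1 a *: (tens X 1 + tens 1 X + tens (X ^+ 2) (X ^+ 2))
  + xcoef 2 a *: (tens (X ^+ 2) 1 + tens 1 (X ^+ 2))
  + xcoef 3 a *: (tens (X ^+ 3) 1 + tens (X ^+ 2) X + tens X (X ^+ 2) + tens 1 (X ^+ 3)).
Proof.
rewrite /F2X4_comul 4!big_ord_recr big_ord0 /= add0r.
by rewrite comulXn0 comulXn1 comulXn2 comulXn3.
Qed.

Lemma F2X4_antipodel a : mul_map (tmap idfun id (F2X4_comul a)) = (xcoef 0 a)%:A.
Proof. by rewrite tmap_id F2X4_antipode. Qed.

Lemma F2X4_antipoder a : mul_map (tmap id idfun (F2X4_comul a)) = (xcoef 0 a)%:A.
Proof. by rewrite tmap_id F2X4_antipode. Qed.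

Lemma xcoef01 : xcoef 0 1 = 1.
Proof. by rewrite xcoef1. Qed.

Definition F2X4_hopf : hopf F2X4 :=
  @Hopf _ F2X4 F2X4_comul (xcoef 0) idfun F2X4_comulA F2X4_counitl F2X4_counitr
    F2X4_comulM F2X4_comul1 xcoefM0 xcoef01 F2X4_antipodel F2X4_antipoder.

Lemma F2X4_hopfP : hopf_formulas F2X4_hopf.
Proof. by split => //=; [exact: F2X4_comulX | rewrite xcoefE]. Qed.

(** Multiplicativity propagates Delta x to all powers of x, so the axioms for an arbitrary [h] can
    be checked on the explicit [F2X4_comul]. *)
Lemma hopf_formulas_comul (h : hopf F2X4) : hopf_formulas h -> comul h =1 F2X4_comul.
Proof.
move=> [hX _ _]; elim/F2X4_ind => [k a b IHa IHb|n _]; first by rewrite !linearP /= IHa IHb.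
rewrite F2X4_comulXn; elim: n => [|n IHn]; first exact: comul1.
by rewrite exprS comulM IHn hX.
Qed.

Lemma hopf_formulas_counit (h : hopf F2X4) : hopf_formulas h -> counit h =1 xcoef 0.
Proof.
move=> [_ hX _]; elim/F2X4_ind => [k a b IHa IHb|[|n] _].
- by rewrite !linearP /= IHa IHb.
- by rewrite counit1 xcoef01.
by rewrite exprS counitM hX mul0r xcoefM0 xcoefX1 // mul0r.
Qed.

(** * The self-duality pairing *)

Definition pairing_form (a b : F2X4) : ('F_2)^o :=
  xcoef 0 a * xcoef 0 b + xcoef 1 a * xcoef 2 b + xcoef 2 a * xcoef 1 b
  + xcoef 3 a * xcoef 3 b.

Definition F2X4_pairing : {linear tensor F2X4 F2X4 -> ('F_2)^o} :=
  tlift pairing_form.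

Lemma F2X4_pairingE a b : F2X4_pairing (tens a b) = pairing_form a b.
Proof.
rewrite /= tliftE //; split=> [c k a1 a2|c k b1 b2]; rewrite /pairing_form !linearP /=.
  by rewrite /GRing.scale /=; ring.
by rewrite /GRing.scale /=; ring.
Qed.

(** Symmetry lets one nondegeneracy proof serve both sides. *)
Lemma F2X4_pairingC a b : F2X4_pairing (tens a b) = F2X4_pairing (tens b a).
Proof. by rewrite !F2X4_pairingE /pairing_form; ring. Qed.

Lemma F2X4_pairing_nondeg a : (forall b, F2X4_pairing (tens a b) = 0) -> a = 0.
Proof.
move=> a0; apply: xcoefP => i i4; rewrite linear0.
have aX0 n : pairing_form a (X ^+ n) = 0 by rewrite -F2X4_pairingE.
(* Pairing with 1, x, x^2, x^3 reads off the coordinates 0, 2, 1, 3 of [a]. *)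
move: i i4 (aX0 0) (aX0 1) (aX0 2) (aX0 3).
rewrite /pairing_form => [[|[|[|[|//]]]]] _; rewrite !xcoefX //=;
  by rewrite !mulr0 !mulr1 ?addr0 ?add0r.
Qed.

Lemma F2X4_pairing_hopf (h : hopf F2X4) : hopf_formulas h ->
  self_duality_pairing h F2X4_pairing.
Proof.
move=> hP; have hc := hopf_formulas_comul hP; have he := hopf_formulas_counit hP.
split.
- exact: F2X4_pairing_nondeg.
- by move=> b b0; apply: F2X4_pairing_nondeg => a; rewrite F2X4_pairingC.
(* Since x and x^2 are dual to each other, the coefficient of c_1 on the right is a_2 b_0 + a_0 b_2
   + a_1 b_1, which is (ab)_2. The term x^2 (x) x^2 of Delta x is thus dual to the product x x =
   x^2. *)
- move=> a b c; rewrite hc F2X4_comul_sum F2X4_pairingE.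
  rewrite pairing2_comulr; cbv zeta beta; rewrite !F2X4_pairingE /pairing_form.
  rewrite !xcoefE //= xcoefM0 xcoefM1 xcoefM2 xcoefM3.
  by ring.
- move=> a b c; rewrite hc F2X4_comul_sum F2X4_pairingE.
  rewrite pairing2_comull; cbv zeta beta; rewrite !F2X4_pairingE /pairing_form.
  rewrite !xcoefE //= xcoefM0 xcoefM1 xcoefM2 xcoefM3.
  by ring.
- move=> a; rewrite he F2X4_pairingE /pairing_form !xcoefE //=; by ring.
- move=> a; rewrite he F2X4_pairingE /pairing_form !xcoefE //=; by ring.
Qed.

Theorem proposition4p1 :
  (exists h : hopf F2X4, hopf_formulas h) /\
  basis_of {:F2X4} [:: 1; X; X ^+ 2; X ^+ 3] /\
  (forall h : hopf F2X4, hopf_formulas h ->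
    self_dual h /\
    exists B : {linear tensor F2X4 F2X4 -> ('F_2)^o},
      self_duality_pairing h B /\
      (forall i j : 'I_4, B (tens (X ^+ i) (X ^+ j)) =
         ((i : nat, j : nat) \in
            [:: (0, 0); (1, 2); (2, 1); (3, 3)]%N)%:R)).
Proof.
split; first by exists F2X4_hopf; exact: F2X4_hopfP.
split=> [|h hP]; first exact: basis_X.
split; first by exists F2X4_pairing; exact: F2X4_pairing_hopf.
exists F2X4_pairing; split=> [|i j]; first exact: F2X4_pairing_hopf.
rewrite F2X4_pairingE /pairing_form !xcoefX //.
(* Sixteen equalities in F_2, each settled by computing representatives. *)
by case: i j => [[|[|[|[|//]]]] ?] [[|[|[|[|//]]]] ?]; apply: val_inj.
Qed.
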